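(* Let $c$ be the midpoint of $[a,b]$. Let $f:[a,b]\to\mathbb{R}$ be such that $f'\in C([a,b])$ and $f''\in HK([a,b])$. Amongst all monic quadratic polynomials $\phi$ used to generate the formula $$\int_a^b f(x)\,dx=\tfrac12\left[-f(a)\phi'(a)+f(b)\phi'(b)+f'(a)\phi(a)-f'(b)\phi(b)\right]+E(f),\qquad(\ast)$$ taking $\phi(x)=(x-c)^2-(b-a)^2/4=(x-a)(x-b)$ minimizes the error $|E(f)|$. This gives the quadrature formula $$\int_a^b f(x)\,dx=\frac{b-a}{2}\left[f(a)+f(b)\right]+E(f),$$ where $$|E(f)|\le\|f''\|(b-a)^2/4.$$ For a uniform partition given by $x_i=a+(b-a)i/n$, $0\le i\le n$, the composite formula is the trapezoidal rule $$\int_a^b f(x)\,dx=\frac{b-a}{2n}\left[f(a)+2\sum_{i=1}^{n-1}f(x_i)+f(b)\right]+E(f),$$ where $$|E(f)|\le\frac{\|f''\|(b-a)^2}{4n}.$$ The coefficient of $\|f''\|$ in the error bounds is the best possible.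
   Context: $[a,b]$ is a compact real interval and $n$ is a positive integer. $HK([a,b])$ is the set of functions integrable in the Henstock–Kurzweil sense on $[a,b]$. For $g\in HK([a,b])$ the Alexiewicz norm is $\|g\|=\sup_{x\in[a,b]}\left|\int_a^x g(t)\,dt\right|$. Formula $(\ast)$ comes from integration by parts, with $\phi$ a monic quadratic polynomial with real coefficients and $E(f)=\tfrac12\int_a^b f''(x)\phi(x)\,dx$; so $E(f)$ in $(\ast)$ depends on the choice of $\phi$. In each quadrature formula $E(f)$ denotes the error of that formula.
   Formalization: ''Minimizes the error |E(f)|'' is false for a single f (f=x²/2 on [0,1], φ=x²−1/3 gives E=0); it is proved for the largest |E(f)| over all f with ‖f''‖≤M, any M≥0. f'' may exist only almost everywhere, provided f' is its HK primitive. *)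

(* Defs.v *)
From Stdlib Require Import Reals Lra Lia ClassicalEpsilon.
From Coquelicot Require Import Coquelicot.
Open Scope R_scope.

(** ** Henstock-Kurzweil integral *)

(** Every cell [x_i, x_(i+1)], with tag t_i, lies in the open interval
    ]t_i - delta t_i, t_i + delta t_i[. *)
Definition HK_fine (delta : R -> posreal) (ptd : @SF_seq R) : Prop :=
  forall i : nat, (i < SF_size ptd)%nat ->
    seq.nth 0 (SF_ly ptd) i - delta (seq.nth 0 (SF_ly ptd) i)
      < seq.nth 0 (SF_lx ptd) i /\
    seq.nth 0 (SF_lx ptd) (S i)
      < seq.nth 0 (SF_ly ptd) i + delta (seq.nth 0 (SF_ly ptd) i).

(** Intended for a <= b.  Unlike in [is_RInt], the mesh is controlled by a gauge,
    which may depend on the tag.  Cells of length 0 are allowed by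
    [pointed_subdiv]; they contribute nothing to [Riemann_sum]. *)
Definition is_HKInt (g : R -> R) (a b I : R) : Prop :=
  forall eps : posreal, exists delta : R -> posreal,
    forall ptd : @SF_seq R,
      pointed_subdiv ptd ->
      SF_h ptd = a ->
      seq.last (SF_h ptd) (SF_lx ptd) = b ->
      HK_fine delta ptd ->
      Rabs (Riemann_sum g ptd - I) < eps.

Definition ex_HKInt (g : R -> R) (a b : R) : Prop :=
  exists I : R, is_HKInt g a b I.

Definition HKInt (g : R -> R) (a b : R) : R := iota (is_HKInt g a b).

(** The supremum is finite whenever [ex_HKInt g a b]. *)
Definition Alex_norm (g : R -> R) (a b : R) : R :=
  real (Lub_Rbar (fun y => exists x, a <= x <= b /\ y = Rabs (HKInt g a x))).

(** ** The functions to be integrated *)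

(** Lebesgue-null sets: countable open covers of arbitrarily small total length. *)
Definition null_set (N : R -> Prop) : Prop :=
  forall eps : posreal, exists u v : nat -> R,
    (forall n, u n <= v n) /\
    (forall x, N x -> exists n, u n < x < v n) /\
    (forall n, sum_n (fun k => v k - u k) n <= eps).

(** [f1] is f' and [f2] is f''; derivatives and continuity are relative to [a,b],
    so one-sided at the end points, and values outside [a,b] are irrelevant.
    As usual for HK([a,b]), f'' need only exist almost everywhere, f' being its
    primitive.  The last clause cannot be dropped for this: if f' is the Cantor
    function then f'' = 0 almost everywhere.  It is automatic when f'' exists at
    every point of [a,b], see [C1_HK2_everywhere]. *)
Record C1_HK2 (a b : R) (f f1 f2 : R -> R) : Prop := {
  C1_HK2_deriv1 : forall x, a <= x <= b ->
    D_in f f1 (fun y => a <= y <= b) x;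
  C1_HK2_cont : continuous_on (fun y => a <= y <= b) f1;
  C1_HK2_deriv2 : exists N, null_set N /\
    forall x, a <= x <= b -> ~ N x -> D_in f1 f2 (fun y => a <= y <= b) x;
  C1_HK2_HK : ex_HKInt f2 a b;
  C1_HK2_primitive : forall x, a <= x <= b -> is_HKInt f2 a x (f1 x - f1 a)
}.

(** ** Quadrature formulas *)

Definition monic_quadratic (phi : R -> R) : Prop :=
  exists p q : R, forall x, phi x = x ^ 2 + p * x + q.

(** The right-hand side without the error term; [f1] is f'. *)
Definition quad_formula (phi f f1 : R -> R) (a b : R) : R :=
  / 2 * (- f a * Derive phi a + f b * Derive phi b
         + f1 a * phi a - f1 b * phi b).

Definition quad_error (phi f2 : R -> R) (a b : R) : R :=
  / 2 * HKInt (fun x => f2 x * phi x) a b.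

(** Largest error of the formula generated by [phi] over all f with
    ||f''|| <= M.  For a single f the error is an affine function of the
    coefficients of [phi] and can usually be made 0 by a choice of [phi]
    depending on f, so it is this quantity that is to be minimized. *)
Definition worst_error (phi : R -> R) (a b M : R) : Rbar :=
  Lub_Rbar (fun y => exists f f1 f2 : R -> R,
    C1_HK2 a b f f1 f2 /\ Alex_norm f2 a b <= M /\
    y = Rabs (quad_error phi f2 a b)).

Definition trapezoid (f : R -> R) (a b : R) : R :=
  (b - a) / 2 * (f a + f b).

Definition node (a b : R) (n i : nat) : R := a + (b - a) * INR i / INR n.

(** The inner sum is 0 for n = 1, since [sum_n_m _ 1 0] is an empty sum. *)
Definition composite_trapezoid (f : R -> R) (a b : R) (n : nat) : R :=
  (b - a) / (2 * INR n) *
  (f a + 2 * sum_n_m (fun i => f (node a b n i)) 1 (n - 1) + f b).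

(** ** Functions with a second derivative at every point *)

Lemma D_in_gauge (F g : R -> R) (a b : R) (eta : posreal) :
  (forall x, a <= x <= b -> D_in F g (fun y => a <= y <= b) x) ->
  exists delta : R -> posreal, forall t y, a <= t <= b -> a <= y <= b ->
    Rabs (y - t) < delta t ->
    Rabs (g t * (y - t) - (F y - F t)) <= eta * Rabs (y - t).
Proof.
intros HD.
assert (H : forall t, exists d : posreal, a <= t <= b -> forall y, a <= y <= b ->
  Rabs (y - t) < d -> Rabs (g t * (y - t) - (F y - F t)) <= eta * Rabs (y - t)).
{ intros t.
  destruct (excluded_middle_informative (a <= t <= b)) as [Ht | Ht];
    [ | exists (mkposreal 1 Rlt_0_1); intros; contradiction ].
  destruct (HD t Ht eta (cond_pos eta)) as [d [Hd H]].
  exists (mkposreal d Hd); intros _ y Hy Hyt; simpl in Hyt.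
  destruct (Req_dec y t) as [-> | Hne].
  - replace (g t * (t - t) - (F t - F t)) with 0 by ring.
    rewrite Rminus_diag, Rabs_R0; lra.
  - specialize (H y); simpl in H; unfold Rdist, D_x in H.
    assert (H' : Rabs ((F y - F t) / (y - t) - g t) < eta).
    { apply H; split; [split; [exact Hy | intro E; apply Hne; now rewrite E] | exact Hyt]. }
    replace (g t * (y - t) - (F y - F t))
      with (- (((F y - F t) / (y - t) - g t) * (y - t))) by (field; lra).
    rewrite Rabs_Ropp, Rabs_mult.
    apply Rmult_le_compat_r; [apply Rabs_pos | lra]. }
exists (fun t => proj1_sig (constructive_indefinite_description _ (H t))).
intros t y Ht.
exact (proj2_sig (constructive_indefinite_description _ (H t)) Ht y).
Qed.

Lemma is_HKInt_derive (F g : R -> R) (a b : R) :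
  (forall x, a <= x <= b -> D_in F g (fun y => a <= y <= b) x) ->
  forall x, a <= x <= b -> is_HKInt g a x (F x - F a).
Proof.
intros HD x Hx eps.
assert (Heta : 0 < eps / (x - a + 1)).
{ apply Rdiv_lt_0_compat; [apply cond_pos | lra]. }
destruct (D_in_gauge F g a b (mkposreal _ Heta) HD) as [delta Hdelta].
exists delta.
intros ptd Hptd Ha Hlast Hfine.
assert (Hmain : forall p : @SF_seq R, pointed_subdiv p -> HK_fine delta p ->
  a <= SF_h p -> seq.last (SF_h p) (SF_lx p) <= b ->
  SF_h p <= seq.last (SF_h p) (SF_lx p) /\
  Rabs (Riemann_sum g p - (F (seq.last (SF_h p) (SF_lx p)) - F (SF_h p)))
    <= eps / (x - a + 1) * (seq.last (SF_h p) (SF_lx p) - SF_h p)).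
{ clear ptd Hptd Ha Hlast Hfine.
  intros p; pattern p; revert p; apply SF_cons_ind.
  - intros x0 _ _ _ _; simpl; unfold Riemann_sum; simpl.
    change (@zero R_ModuleSpace) with 0.
    replace (0 - (F x0 - F x0)) with 0 by ring.
    rewrite Rabs_R0; lra.
  - intros [h t] s IH Hp Hf Hh Hl.
    assert (Hps := ptd_cons _ _ Hp).
    assert (H0 : h <= t <= SF_h s).
    { apply (Hp 0%nat); rewrite SF_size_cons; lia. }
    assert (H1 : t - delta t < h /\ SF_h s < t + delta t).
    { apply (Hf 0%nat); rewrite SF_size_cons; lia. }
    assert (Hfs : HK_fine delta s).
    { intros i Hi; apply (Hf (S i)); rewrite SF_size_cons; lia. }
    rewrite Riemann_sum_cons.
    change (SF_h (SF_cons (h, t) s)) with h in *.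
    change (seq.last h (SF_lx (SF_cons (h, t) s)))
      with (seq.last (SF_h s) (SF_lx s)) in *.
    destruct (IH Hps Hfs) as [IH1 IH2]; [lra | exact Hl | ].
    split; [lra | ].
    set (l := seq.last (SF_h s) (SF_lx s)) in *.
    simpl fst; simpl snd.
    change (plus (scal (SF_h s - h) (g t)) (Riemann_sum g s))
      with ((SF_h s - h) * g t + Riemann_sum g s).
    assert (A1 := Hdelta t h). assert (A2 := Hdelta t (SF_h s)).
    simpl in A1, A2.
    rewrite Rabs_left1 with (a := h - t) in A1 by lra.
    rewrite Rabs_pos_eq with (x := SF_h s - t) in A2 by lra.
    assert (B1 := A1 ltac:(lra) ltac:(lra) ltac:(lra)).
    assert (B2 := A2 ltac:(lra) ltac:(lra) ltac:(lra)).
    apply Rabs_le_between in B1; apply Rabs_le_between in B2.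
    apply Rabs_le_between in IH2; apply Rabs_le_between.
    set (e := eps / (x - a + 1)) in *; nra. }
destruct (Hmain ptd Hptd Hfine) as [_ H]; [lra | lra | ].
rewrite Hlast, Ha in H.
apply Rle_lt_trans with (1 := H).
assert (E : eps / (x - a + 1) * (x - a + 1) = eps) by (field; lra).
rewrite <- E at 2; apply Rmult_lt_compat_l; lra.
Qed.

Lemma C1_HK2_everywhere (a b : R) (f f1 f2 : R -> R) : a <= b ->
  (forall x, a <= x <= b -> D_in f f1 (fun y => a <= y <= b) x) ->
  (forall x, a <= x <= b -> D_in f1 f2 (fun y => a <= y <= b) x) ->
  C1_HK2 a b f f1 f2.
Proof.
intros Hab H1 H2.
assert (H3 := is_HKInt_derive f1 f2 a b H2).
split; try assumption.
- intros x Hx P [eps HP].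
  destruct (cont_deriv _ _ _ _ (H2 x Hx) eps (cond_pos eps)) as [d [Hd H]].
  exists (mkposreal d Hd); intros y Hy HyD; apply HP.
  destruct (Req_dec y x) as [-> | Hne]; [apply ball_center | ].
  apply H; split; [split; [exact HyD | now intro E; apply Hne] | exact Hy].
- exists (fun _ => False); split; [ | now intros; apply H2].
  intros eps; exists (fun _ => 0), (fun _ => 0); split; [ | split].
  + intros; lra.
  + intros x [].
  + intros n; rewrite (sum_n_ext _ (fun _ => 0)) by (intros; apply Rminus_diag).
    rewrite sum_n_const, Rmult_0_r; apply Rlt_le, cond_pos.
- exists (f1 b - f1 a); apply H3; lra.
Qed.

(* Main.v *)
Require Import Defs.
From Stdlib Require Import Reals Lra Lia List ClassicalEpsilon.
From Coquelicot Require Import Coquelicot.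
Open Scope R_scope.

(** Integration by parts against [f''] turns the error of the formula generated by
    [phi] into an integral of [f' - f'(a)], whose supremum is the Alexiewicz norm
    of [f''].  On a cell of length [h] the function [f - f'(a) x] is therefore
    Lipschitz with constant ||f''||, which bounds the trapezoidal error by
    ||f''|| h^2 / 4; the sum over [n] cells gives the composite bound.

    Conversely, [A asin (sin rho cos (2 pi n (x - a) / (b - a)))] has integral 0,
    takes the value [A rho] at all nodes, and its derivative vanishes at [a] and
    [b] and is bounded by [2 pi n A / (b - a)].  Letting [rho] tend to [pi / 2] shows
    that the bounds are sharp.  For [n = 1] these functions have the same error
    whatever [phi] is, so no [phi] can beat [(x - a) (x - b)]. *)

(** * Tagged partitions as lists *)

(** The cells of [p] are given by their right end point and their tag. *)
Fixpoint tagged (delta : R -> posreal) (u : R) (p : list (R * R)) (v : R) : Prop :=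
  match p with
  | nil => u = v
  | (w, t) :: q =>
      (u <= t <= w /\ t - delta t < u /\ w < t + delta t) /\ tagged delta w q v
  end.

Fixpoint tsum (g : R -> R) (u : R) (p : list (R * R)) : R :=
  match p with
  | nil => 0
  | (w, t) :: q => (w - u) * g t + tsum g w q
  end.

Lemma tsum_Riemann_sum (g : R -> R) (u : R) (p : list (R * R)) :
  Riemann_sum g (mkSF_seq u p) = tsum g u p.
Proof.
revert u; induction p as [ | [w t] q IH]; intros u; [reflexivity | ].
change (mkSF_seq u ((w, t) :: q)) with (SF_cons (u, t) (mkSF_seq w q)).
rewrite Riemann_sum_cons, IH; reflexivity.
Qed.

Lemma tagged_SF_seq (delta : R -> posreal) (u : R) (p : list (R * R)) (v : R) :
  tagged delta u p v <->
  pointed_subdiv (mkSF_seq u p) /\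
  seq.last u (SF_lx (mkSF_seq u p)) = v /\ HK_fine delta (mkSF_seq u p).
Proof.
revert u; induction p as [ | [w t] q IH]; intros u.
- split; [ | intros (_ & H & _); exact H].
  intros H; split; [ | split; [exact H | ]]; intros i Hi; inversion Hi.
- change (mkSF_seq u ((w, t) :: q)) with (SF_cons (u, t) (mkSF_seq w q)).
  simpl tagged; rewrite IH; split.
  + intros [(H1 & H2 & H3) (Hp & Hl & Hf)]; split; [ | split; [exact Hl | ]].
    * intros [ | i] Hi; [exact H1 | ].
      rewrite SF_size_cons in Hi; apply (Hp i); lia.
    * intros [ | i] Hi; [exact (conj H2 H3) | ].
      rewrite SF_size_cons in Hi; apply (Hf i); lia.
  + intros (Hp & Hl & Hf).
    assert (H1 : u <= t <= w) by (apply (Hp 0%nat); rewrite SF_size_cons; lia).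
    assert (H2 : t - delta t < u /\ w < t + delta t)
      by (apply (Hf 0%nat); rewrite SF_size_cons; lia).
    split; [tauto | split; [exact (ptd_cons _ _ Hp) | split; [exact Hl | ]]].
    intros i Hi; apply (Hf (S i)); rewrite SF_size_cons; lia.
Qed.

(** Both sides say the same, as an [SF_seq] is a left end point together with such a list. Lists can
    be concatenated at a node and lend themselves to induction. *)
Lemma is_HKInt_tsum (g : R -> R) (a b I : R) :
  is_HKInt g a b I <->
  forall eps : posreal, exists delta : R -> posreal,
    forall p, tagged delta a p b -> Rabs (tsum g a p - I) < eps.
Proof.
split; intros H eps; destruct (H eps) as [delta Hd]; exists delta.
- intros p Hp; rewrite <- tsum_Riemann_sum.
  destruct (proj1 (tagged_SF_seq _ _ _ _) Hp) as (H1 & H2 & H3).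
  now apply Hd.
- intros [h p] Hp Ha Hb Hf; simpl in Ha; subst h.
  rewrite tsum_Riemann_sum; apply Hd, tagged_SF_seq; auto.
Qed.

Lemma tagged_le (delta : R -> posreal) (p : list (R * R)) (u v : R) :
  tagged delta u p v -> u <= v.
Proof.
revert u; induction p as [ | [w t] q IH]; simpl; intros u H; [lra | ].
destruct H as [H1 H2]; apply IH in H2; lra.
Qed.

Lemma tagged_app (delta : R -> posreal) (p q : list (R * R)) (u w v : R) :
  tagged delta u p w -> tagged delta w q v -> tagged delta u (p ++ q) v.
Proof.
revert u; induction p as [ | [x t] p IH]; simpl; intros u Hp Hq;
  [now subst | ].
destruct Hp; split; auto.
Qed.

Lemma tsum_app (g : R -> R) (delta : R -> posreal) (p q : list (R * R)) (u w : R) :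
  tagged delta u p w -> tsum g u (p ++ q) = tsum g u p + tsum g w q.
Proof.
revert u; induction p as [ | [x t] p IH]; simpl; intros u Hp;
  [subst; ring | ].
destruct Hp; rewrite IH; auto; ring.
Qed.

Lemma tagged_weaken (delta delta' : R -> posreal) (p : list (R * R)) (u v : R) :
  (forall t, delta t <= delta' t) -> tagged delta u p v -> tagged delta' u p v.
Proof.
intros Hd; revert u; induction p as [ | [w t] q IH]; simpl; intros u H; auto.
destruct H as [H1 H2]; split; auto.
specialize (Hd t); lra.
Qed.

Definition gauge_min (d1 d2 : R -> posreal) (t : R) : posreal :=
  mkposreal (Rmin (d1 t) (d2 t)) (Rmin_stable_in_posreal (d1 t) (d2 t)).

Lemma tagged_gauge_min (d1 d2 : R -> posreal) (p : list (R * R)) (u v : R) :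
  tagged (gauge_min d1 d2) u p v -> tagged d1 u p v /\ tagged d2 u p v.
Proof.
intros H; split; revert H; apply tagged_weaken; intros t; simpl;
  [apply Rmin_l | apply Rmin_r].
Qed.

(** Let [m] be the supremum of the points reachable from [u] by a fine partition. Some reachable [x]
    lies within [delta m] of [m], and one cell with tag [m] leads from [x] past [m] unless [v] comes
    first; hence [v] is reachable. *)
Lemma cousin (delta : R -> posreal) (u v : R) :
  u <= v -> exists p, tagged delta u p v.
Proof.
intros Huv.
set (E := fun x => u <= x <= v /\ exists p, tagged delta u p x).
destruct (completeness E) as [m [Hub Hlub]].
- exists v; intros x [Hx _]; lra.
- exists u; split; [lra | exists nil; reflexivity].
- assert (Hm : m <= v) by (apply Hlub; intros x [Hx _]; lra).
  assert (Hx : exists x, E x /\ m - delta m < x).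
  { destruct (excluded_middle_informative (exists x, E x /\ m - delta m < x))
      as [H | H]; [exact H | exfalso].
    assert (m <= m - delta m).
    { apply Hlub; intros x Ex; apply Rnot_lt_le; intros Hlt; apply H.
      now exists x. }
    assert (Hd := cond_pos (delta m)); lra. }
  destruct Hx as [x [[Hux [p Hp]] Hmx]].
  assert (Hxm : x <= m) by (apply Hub; split; [lra | now exists p]).
  assert (Hd := cond_pos (delta m)).
  set (y := Rmin v (m + delta m / 2)).
  assert (Hy : m <= y <= v /\ y <= m + delta m / 2).
  { unfold y, Rmin; destruct (Rle_dec v (m + delta m / 2)); lra. }
  assert (Ey : exists q, tagged delta u q y).
  { exists (p ++ ((y, m) :: nil))%list; apply tagged_app with (1 := Hp).
    simpl; lra. }
  assert (Hym : y <= m) by (apply Hub; split; [lra | exact Ey]).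
  replace v with y; [exact Ey | ].
  unfold y, Rmin in *; destruct (Rle_dec v (m + delta m / 2)); lra.
Qed.

(** * Henstock-Kurzweil integral *)

(** By [cousin] some partition is fine for both gauges; its sum is close to [I] and to [J]. *)
Lemma is_HKInt_unique (g : R -> R) (a b I J : R) : a <= b ->
  is_HKInt g a b I -> is_HKInt g a b J -> I = J.
Proof.
intros Hab HI HJ.
assert (HI' := proj1 (is_HKInt_tsum _ _ _ _) HI).
assert (HJ' := proj1 (is_HKInt_tsum _ _ _ _) HJ).
apply cond_eq; intros e He.
assert (He2 : 0 < e / 2) by lra.
destruct (HI' (mkposreal _ He2)) as [d1 H1], (HJ' (mkposreal _ He2)) as [d2 H2].
destruct (cousin (gauge_min d1 d2) a b Hab) as [p Hp].
apply tagged_gauge_min in Hp as [Hp1 Hp2].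
specialize (H1 p Hp1); specialize (H2 p Hp2); simpl in H1, H2.
apply Rabs_def2 in H1, H2; apply Rabs_def1; lra.
Qed.

Lemma HKInt_correct (g : R -> R) (a b I : R) : a <= b ->
  is_HKInt g a b I -> HKInt g a b = I.
Proof.
intros Hab HI; apply (@iota_unique _ R_CompleteNormedModule); [ | exact HI].
intros J HJ; exact (is_HKInt_unique g a b J I Hab HJ HI).
Qed.

Lemma is_HKInt_zero (a b : R) : is_HKInt (fun _ => 0) a b 0.
Proof.
apply is_HKInt_tsum; intros eps; exists (fun _ => eps); intros p _.
replace (tsum _ a p) with 0.
- rewrite Rminus_0_r, Rabs_R0; apply cond_pos.
- generalize a; induction p as [ | [w t] q IH]; intros u; simpl;
    [reflexivity | rewrite <- IH; ring].
Qed.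

(* Completing [p] to the left by a partition of [a,x] that is also fine for
   a second gauge shows that only the cells of [p] can be responsible for the
   error. *)
Lemma tsum_tail_error (f F : R -> R) (a b : R) (e : posreal) (delta : R -> posreal) :
  (forall x, a <= x <= b -> is_HKInt f a x (F x - F a)) ->
  (forall p, tagged delta a p b -> Rabs (tsum f a p - (F b - F a)) < e) ->
  forall x p, a <= x -> tagged delta x p b ->
    Rabs (tsum f x p - (F b - F x)) <= 2 * e.
Proof.
intros HF Hd x p Hax Hp.
assert (Hxb := tagged_le _ _ _ _ Hp).
destruct (proj1 (is_HKInt_tsum _ _ _ _) (HF x (conj Hax Hxb)) e) as [d2 H2].
destruct (cousin (gauge_min delta d2) a x Hax) as [q Hq].
apply tagged_gauge_min in Hq as [Hq1 Hq2].
specialize (H2 q Hq2).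
assert (H1 := Hd (q ++ p)%list (tagged_app _ _ _ _ _ _ Hq1 Hp)).
rewrite (tsum_app f _ _ _ _ _ Hq1) in H1.
apply Rabs_def2 in H1, H2; apply Rabs_le; lra.
Qed.

Lemma is_derive_gauge (u : R -> R) (t l : R) (e : posreal) :
  is_derive u t l -> exists d : posreal, forall y, Rabs (y - t) < d ->
    Rabs (u y - u t - l * (y - t)) <= e * Rabs (y - t).
Proof.
intros H; apply is_derive_Reals in H.
destruct (H e (cond_pos e)) as [d Hd]; exists d; intros y Hy.
destruct (Req_dec y t) as [-> | Hne].
- replace (u t - u t - l * (t - t)) with 0 by ring.
  rewrite Rminus_diag, Rabs_R0; lra.
- assert (H1 := Hd (y - t) ltac:(lra) Hy).
  replace (t + (y - t)) with y in H1 by ring.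
  replace (u y - u t - l * (y - t)) with (((u y - u t) / (y - t) - l) * (y - t))
    by (field; lra).
  rewrite Rabs_mult; apply Rmult_le_compat_r; [apply Rabs_pos | lra].
Qed.

(** * Integration by parts for the Henstock-Kurzweil integral *)

Section Parts.

Variables (f F phi phi' K : R -> R) (a b L : R).
Hypothesis Hab : a <= b.
Hypothesis HF : forall x, a <= x <= b -> is_HKInt f a x (F x - F a).
Hypothesis HFc : forall x, a <= x <= b -> continuous F x.
Hypothesis Hphi : forall x, a <= x <= b -> is_derive phi x (phi' x).
Hypothesis HL0 : 0 <= L.
Hypothesis HL : forall x y, a <= x <= b -> a <= y <= b ->
  Rabs (phi x - phi y) <= L * Rabs (x - y).
Hypothesis HK : forall x, a <= x <= b -> is_derive K x (F x * phi' x).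

(** As [K] is a primitive of [F * phi'], this is the expected primitive of [f * phi]. *)
Let H x := F x * phi x - K x.

(* Around [t], [H y - phi t * F y] is constant up to [o (y - t)]. *)
Lemma parts_gauge (e : posreal) : exists delta : R -> posreal,
  forall t y, a <= t <= b -> a <= y <= b -> Rabs (y - t) < delta t ->
    Rabs (F y * (phi y - phi t) - (K y - K t)) <= e * (1 + L) * Rabs (y - t).
Proof.
assert (Hloc : forall t, exists d : posreal, a <= t <= b ->
  forall y, a <= y <= b -> Rabs (y - t) < d ->
    Rabs (F y * (phi y - phi t) - (K y - K t)) <= e * (1 + L) * Rabs (y - t)).
{ intros t; destruct (excluded_middle_informative (a <= t <= b)) as [Ht | Ht];
    [ | exists e; intros; contradiction].
  (* With [F] frozen at [t], the function has derivative 0 at [t]. The rest,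
     [(F y - F t) * (phi y - phi t)], is small by continuity of [F] and the Lipschitz bound on
     [phi]. *)
  destruct (is_derive_gauge (fun y => F t * phi y - K y) t 0 e) as [d1 H1].
  { replace 0 with (minus (scal (F t) (phi' t)) (F t * phi' t))
      by apply Rminus_diag.
    apply (@is_derive_minus _ R_NormedModule); [ | now apply HK].
    apply is_derive_scal; now apply Hphi. }
  destruct (proj1 (filterlim_locally F (F t)) (HFc t Ht) e) as [d2 H2].
  exists (gauge_min (fun _ => d1) (fun _ => d2) t).
  intros _ y Hy Hyt; simpl in Hyt.
  assert (Hy1 := Rlt_le_trans _ _ _ Hyt (Rmin_l _ _)).
  assert (Hy2 := Rlt_le_trans _ _ _ Hyt (Rmin_r _ _)).
  specialize (H1 y Hy1); specialize (H2 y Hy2).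
  change (Rabs (F y - F t) < e) in H2; simpl in H1.
  replace (F y * (phi y - phi t) - (K y - K t)) with
    ((F t * phi y - K y - (F t * phi t - K t) - 0 * (y - t))
     + (F y - F t) * (phi y - phi t)) by ring.
  apply Rle_trans with (1 := Rabs_triang _ _).
  rewrite (Rabs_mult (F y - F t)).
  assert (Rabs (F y - F t) * Rabs (phi y - phi t) <= e * (L * Rabs (y - t))).
  { apply Rmult_le_compat; try apply Rabs_pos; [lra | now apply HL]. }
  lra. }
exists (fun t => proj1_sig (constructive_indefinite_description _ (Hloc t))).
intros t y Ht.
exact (proj2_sig (constructive_indefinite_description _ (Hloc t)) Ht y).
Qed.

(* Summation by parts: the weights [phi t] vary little, so that the error of the
   weighted sum is controlled by the errors [D] of the sums over the tails. *)
Lemma parts_tail (e : posreal) (delta : R -> posreal) :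
  (forall x p, a <= x -> tagged delta x p b ->
     Rabs (tsum f x p - (F b - F x)) <= 2 * e) ->
  (forall t y, a <= t <= b -> a <= y <= b -> Rabs (y - t) < delta t ->
     Rabs (F y * (phi y - phi t) - (K y - K t)) <= e * (1 + L) * Rabs (y - t)) ->
  forall p x, a <= x -> tagged delta x p b ->
    Rabs (tsum (fun s => f s * phi s) x p - (H b - H x)
          - phi x * (tsum f x p - (F b - F x))) <= e * (1 + 7 * L) * (b - x).
Proof.
intros HD HW p; induction p as [ | [w t] q IH]; intros x Hax Hp.
- simpl in *; subst x.
  replace (0 - (H b - H b) - phi b * (0 - (F b - F b))) with 0 by ring.
  rewrite Rabs_R0; lra.
- assert (HDx := HD _ _ Hax Hp).
  simpl in Hp; destruct Hp as [(Hc1 & Hc2 & Hc3) Hq].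
  assert (Hwb := tagged_le _ _ _ _ Hq).
  assert (Haw : a <= w) by lra.
  specialize (IH w Haw Hq).
  assert (HDw := HD _ _ Haw Hq).
  assert (Hx := HW t x ltac:(lra) ltac:(lra)).
  assert (Hw := HW t w ltac:(lra) ltac:(lra)).
  rewrite (Rabs_left1 (x - t)) in Hx by lra.
  rewrite (Rabs_pos_eq (w - t)) in Hw by lra.
  specialize (Hx ltac:(lra)); specialize (Hw ltac:(lra)).
  assert (L1 := HL t x ltac:(lra) ltac:(lra)).
  assert (L2 := HL w x ltac:(lra) ltac:(lra)).
  rewrite (Rabs_pos_eq (t - x)) in L1 by lra.
  rewrite (Rabs_pos_eq (w - x)) in L2 by lra.
  simpl tsum in *.
  set (s := tsum f w q) in *; set (r := tsum (fun s => f s * phi s) w q) in *.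
  set (D := (w - x) * f t + s - (F b - F x)) in *.
  set (D' := s - (F b - F w)) in *.
  (* [D - D'] is the error of the first cell, at most [4 * e]; the middle group is controlled by the
     gauge at [x] and [w]; the term with [r] is the induction hypothesis. Per unit length the new
     terms cost [4 * e * L], [e * (1 + L)] and [2 * e * L], which explains the 7. *)
  replace ((w - x) * (f t * phi t) + r - (H b - H x) - phi x * D) with
    ((phi t - phi x) * (D - D')
     + ((F x * (phi x - phi t) - (K x - K t))
        + - (F w * (phi w - phi t) - (K w - K t)))
     + ((r - (H b - H w) - phi w * D') + (phi w - phi x) * D'))
    by (unfold D, D', H; ring).
  assert (M1 : Rabs ((phi t - phi x) * (D - D')) <= L * (w - x) * (4 * e)).
  { rewrite Rabs_mult; apply Rmult_le_compat; try apply Rabs_pos.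
    - apply Rle_trans with (1 := L1); apply Rmult_le_compat_l; lra.
    - apply Rabs_le_between in HDx; apply Rabs_le_between in HDw.
      apply Rabs_le; lra. }
  assert (M2 : Rabs ((phi w - phi x) * D') <= L * (w - x) * (2 * e)).
  { rewrite Rabs_mult; apply Rmult_le_compat; try apply Rabs_pos; assumption. }
  apply Rle_trans with (1 := Rabs_triang _ _).
  assert (T1 := Rabs_triang ((phi t - phi x) * (D - D'))
     ((F x * (phi x - phi t) - (K x - K t))
        + - (F w * (phi w - phi t) - (K w - K t)))).
  assert (T2 := Rabs_triang (F x * (phi x - phi t) - (K x - K t))
        (- (F w * (phi w - phi t) - (K w - K t)))).
  assert (T3 := Rabs_triang (r - (H b - H w) - phi w * D') ((phi w - phi x) * D')).
  rewrite Rabs_Ropp in T2.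
  lra.
Qed.

Lemma is_HKInt_parts :
  is_HKInt (fun x => f x * phi x) a b (F b * phi b - K b - (F a * phi a - K a)).
Proof.
apply is_HKInt_tsum; intros eps.
(* For [x = a], [parts_tail] leaves [phi a] times the total error, at most [2 * e * Rabs (phi a)].
   [A] collects all factors of [e]; the added 1 makes it positive and the final inequality
   strict. *)
set (A := (1 + 7 * L) * (b - a) + 2 * Rabs (phi a) + 1).
assert (HA1 : 0 <= (1 + 7 * L) * (b - a)) by (apply Rmult_le_pos; lra).
assert (Hpa := Rabs_pos (phi a)).
assert (HA : 0 < A) by (unfold A; lra).
assert (He : 0 < eps / A) by (apply Rdiv_lt_0_compat; [apply cond_pos | exact HA]).
set (e := mkposreal _ He).
destruct (proj1 (is_HKInt_tsum _ _ _ _) (HF b ltac:(lra)) e) as [d1 H1].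
destruct (parts_gauge e) as [d2 H2].
exists (gauge_min d1 d2); intros p Hp.
assert (H3 : forall x p, a <= x -> tagged (gauge_min d1 d2) x p b ->
  Rabs (tsum f x p - (F b - F x)) <= 2 * e).
{ intros x q Hax Hq; apply tagged_gauge_min in Hq as [Hq _].
  now apply (tsum_tail_error f F a b e d1). }
assert (H4 : Rabs (tsum (fun s => f s * phi s) a p - (H b - H a)
          - phi a * (tsum f a p - (F b - F a))) <= e * (1 + 7 * L) * (b - a)).
{ apply (parts_tail e (gauge_min d1 d2)); [exact H3 | | lra | exact Hp].
  intros t y Ht Hy Hyt; apply H2; auto.
  apply Rlt_le_trans with (1 := Hyt); apply Rmin_r. }
specialize (H3 a p ltac:(lra) Hp).
assert (H5 : Rabs (phi a * (tsum f a p - (F b - F a))) <= Rabs (phi a) * (2 * e)).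
{ rewrite Rabs_mult; apply Rmult_le_compat_l; assumption. }
change (F b * phi b - K b - (F a * phi a - K a)) with (H b - H a).
assert (HeA : e * A = eps) by (simpl; field; lra).
unfold A in HeA.
apply Rabs_le_between in H4; apply Rabs_le_between in H5.
apply Rabs_def1; simpl in *; lra.
Qed.

End Parts.

(** * Extension of [f] and [f'] from [a,b] to the line *)

Lemma D_in_is_derive (F : R -> R) (g : R -> R) (D : R -> Prop) (x : R) :
  is_derive F x (g x) -> D_in F g D x.
Proof.
intros H; apply is_derive_Reals, derivable_pt_lim_D_in in H.
intros eps Heps; destruct (H eps Heps) as [d [Hd Hlim]].
exists d; split; [exact Hd | ].
intros y [[_ Hne] Hy]; apply Hlim; split; [split; [exact I | exact Hne] | exact Hy].
Qed.

(** The zero function has integral [F x - F a] by [is_HKInt_derive], and 0 by direct computation. *)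
Lemma D_in_zero_constant (F : R -> R) (a b : R) :
  (forall x, a <= x <= b -> D_in F (fun _ => 0) (fun y => a <= y <= b) x) ->
  forall x, a <= x <= b -> F x = F a.
Proof.
intros HD x Hx.
assert (H := is_HKInt_derive F (fun _ => 0) a b HD x Hx).
assert (H0 := is_HKInt_unique _ _ _ _ _ (proj1 Hx) H (is_HKInt_zero a x)).
lra.
Qed.

(** For [a <= b], the nearest-point retraction onto [a,b]; composing with it extends a function by
    its end values. *)
Definition clamp (a b x : R) : R := Rmax a (Rmin b x).

Lemma clamp_in (a b x : R) : a <= b -> a <= clamp a b x <= b.
Proof.
intros Hab; unfold clamp, Rmax, Rmin.
destruct (Rle_dec b x); destruct Rle_dec; lra.
Qed.

Lemma clamp_id (a b x : R) : a <= x <= b -> clamp a b x = x.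
Proof.
intros Hx; unfold clamp, Rmax, Rmin.
destruct (Rle_dec b x); destruct Rle_dec; lra.
Qed.

Lemma clamp_lipschitz (a b x y : R) : a <= b ->
  Rabs (clamp a b y - clamp a b x) <= Rabs (y - x).
Proof.
intros Hab; unfold clamp, Rmax, Rmin.
destruct (Rle_dec b x); destruct (Rle_dec b y); repeat destruct Rle_dec;
  unfold Rabs; repeat destruct Rcase_abs; lra.
Qed.

Lemma continuous_clamp (f : R -> R) (a b : R) : a <= b ->
  continuous_on (fun y => a <= y <= b) f ->
  forall x, continuous (fun y => f (clamp a b y)) x.
Proof.
intros Hab Hf x.
apply filterlim_comp with (2 := Hf (clamp a b x) (clamp_in a b x Hab)).
intros P [d Hd]; exists d; intros y Hy; apply Hd; [ | now apply clamp_in].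
apply Rle_lt_trans with (2 := Hy); now apply clamp_lipschitz.
Qed.

Lemma continuous_primitive (g : R -> R) (a : R) :
  (forall x, continuous g x) -> forall x, is_derive (RInt g a) x (g x).
Proof.
intros Hg x; apply is_derive_RInt with a; [ | apply Hg].
apply filter_forall; intros y; apply (@RInt_correct R_CompleteNormedModule).
apply (@ex_RInt_continuous R_CompleteNormedModule); auto.
Qed.

(** The hypotheses on [f] are one-sided at the end points, whereas [is_derive] is two-sided.
    Clamping [f1] gives [G], and [F] is its primitive with [F a = f a]; then [F - f] has derivative
    0 relative to [a,b], so it is constant. *)
Lemma C1_HK2_extension (a b : R) (f f1 f2 : R -> R) : a <= b ->
  C1_HK2 a b f f1 f2 -> exists F G : R -> R,
    (forall x, is_derive F x (G x)) /\ (forall x, continuous G x) /\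
    (forall x, a <= x <= b -> F x = f x /\ G x = f1 x).
Proof.
intros Hab Hf.
set (G := fun x => f1 (clamp a b x)).
assert (HG : forall x, continuous G x)
  by exact (continuous_clamp f1 a b Hab (C1_HK2_cont _ _ _ _ _ Hf)).
assert (HGf : forall x, a <= x <= b -> G x = f1 x)
  by (intros x Hx; unfold G; now rewrite clamp_id).
exists (fun x => f a + RInt G a x), G.
assert (HF : forall x, is_derive (fun x => f a + RInt G a x) x (G x)).
{ intros x; rewrite <- (Rplus_0_l (G x)).
  apply (@is_derive_plus _ R_NormedModule);
    [apply (@is_derive_const _ R_NormedModule) | now apply continuous_primitive]. }
split; [exact HF | split; [exact HG | ]].
intros x Hx; split; [ | now apply HGf].
assert (H := D_in_zero_constant (fun x => f a + RInt G a x - f x) a b).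
cbv beta in H; rewrite (RInt_point a G : RInt G a a = 0) in H.
enough (f a + RInt G a x - f x = f a + 0 - f a) by lra.
apply H; [ | exact Hx].
intros y Hy eps Heps.
assert (HD := Dminus _ _ _ _ _ _ (D_in_is_derive _ G (fun y => a <= y <= b) y (HF y))
  (C1_HK2_deriv1 _ _ _ _ _ Hf y Hy)).
unfold D_in in HD; rewrite (HGf y Hy), Rminus_diag in HD.
exact (HD eps Heps).
Qed.

Lemma C1_HK2_ex_RInt (a b : R) (f f1 f2 : R -> R) : a <= b ->
  C1_HK2 a b f f1 f2 -> ex_RInt f a b.
Proof.
intros Hab Hf.
destruct (C1_HK2_extension a b f f1 f2 Hab Hf) as (F & G & HF & _ & HFG).
apply ex_RInt_ext with F.
- intros x Hx; rewrite Rmin_left, Rmax_right in Hx by exact Hab; apply HFG; lra.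
- apply (@ex_RInt_continuous R_CompleteNormedModule); intros x _.
  apply (@ex_derive_continuous _ R_NormedModule); exists (G x); apply HF.
Qed.

(** * The Alexiewicz norm of a second derivative *)

Lemma C1_HK2_HKInt (a b : R) (f f1 f2 : R -> R) (x : R) :
  C1_HK2 a b f f1 f2 -> a <= x <= b -> HKInt f2 a x = f1 x - f1 a.
Proof.
intros Hf Hx; apply HKInt_correct; [lra | ].
now apply (C1_HK2_primitive _ _ _ _ _ Hf).
Qed.

(** The norm is the supremum of [Rabs (f1 x - f1 a)]. The bound [M] excludes the value [p_infty],
    which [real] would turn into 0; the point [x = a] excludes [m_infty]. *)
Lemma Alex_norm_le (a b : R) (f f1 f2 : R -> R) (M : R) : a <= b ->
  C1_HK2 a b f f1 f2 -> (forall x, a <= x <= b -> Rabs (f1 x - f1 a) <= M) ->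
  Alex_norm f2 a b <= M /\
  forall x, a <= x <= b -> Rabs (f1 x - f1 a) <= Alex_norm f2 a b.
Proof.
intros Hab Hf HM; unfold Alex_norm.
set (E := fun y => exists x, a <= x <= b /\ y = Rabs (HKInt f2 a x)).
destruct (Lub_Rbar_correct E) as [Hub Hlub].
assert (HE : forall x, a <= x <= b -> E (Rabs (f1 x - f1 a))).
{ intros x Hx; exists x; split; [exact Hx | ].
  now rewrite (C1_HK2_HKInt a b f f1 f2). }
assert (H1 : Rbar_le (Lub_Rbar E) M).
{ apply Hlub; intros y (x & Hx & ->).
  rewrite (C1_HK2_HKInt a b f f1 f2) by assumption; now apply HM. }
assert (H2 : forall x, a <= x <= b -> Rbar_le (Rabs (f1 x - f1 a)) (Lub_Rbar E))
  by (intros x Hx; now apply Hub, HE).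
destruct (Lub_Rbar E) as [l | | ]; simpl in *.
- now split.
- contradiction.
- destruct (H2 a); lra.
Qed.

(** Continuity of [f1] on a compact interval supplies the finite bound that [Alex_norm_le] asks
    for. *)
Lemma Alex_norm_bound (a b : R) (f f1 f2 : R -> R) : a <= b ->
  C1_HK2 a b f f1 f2 ->
  forall x, a <= x <= b -> Rabs (f1 x - f1 a) <= Alex_norm f2 a b.
Proof.
intros Hab Hf.
destruct (C1_HK2_extension a b f f1 f2 Hab Hf) as (F & G & _ & HG & HFG).
destruct (@bounded_continuity _ R_NormedModule G a b) as [M HM];
  [intros; apply HG | ].
apply (Alex_norm_le a b f f1 f2 (M + M) Hab Hf).
intros x Hx.
destruct (HFG x Hx) as [_ <-]; destruct (HFG a ltac:(lra)) as [_ <-].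
assert (H1 := HM x Hx); assert (H2 := HM a ltac:(lra)).
change (Rabs (G x) < M) in H1; change (Rabs (G a) < M) in H2.
apply Rabs_def2 in H1, H2; apply Rabs_le; lra.
Qed.

(** * The quadrature formulas *)

Lemma is_derive_monic_quadratic (phi : R -> R) (p q : R) :
  (forall x, phi x = x ^ 2 + p * x + q) ->
  forall x, is_derive phi x (2 * x + p).
Proof.
intros Hphi x; apply is_derive_ext with (fun x => x ^ 2 + p * x + q);
  [now intros; symmetry | ].
auto_derive; [exact I | ring].
Qed.

(** Two integrations by parts: [is_HKInt_parts] leads from [f'' phi] to [f' phi'], and a classical
    one from there to [f phi''], which is [2 f] because [phi] is monic. *)
Lemma quad_formula_error (a b : R) (f f1 f2 phi : R -> R) : a <= b ->
  C1_HK2 a b f f1 f2 -> monic_quadratic phi ->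
  ex_HKInt (fun x => f2 x * phi x) a b /\
  RInt f a b = quad_formula phi f f1 a b + quad_error phi f2 a b.
Proof.
intros Hab Hf (p & q & Hphi).
assert (Hd := is_derive_monic_quadratic phi p q Hphi).
destruct (C1_HK2_extension a b f f1 f2 Hab Hf) as (F & G & HF & HG & HFG).
assert (Hw : forall x, continuous (fun x => 2 * x + p) x).
{ intros x; apply (@ex_derive_continuous _ R_NormedModule); auto_derive; exact I. }
assert (HGw : forall x, continuous (fun x => G x * (2 * x + p)) x)
  by (intros x; apply (@continuous_mult R_UniformSpace R_AbsRing); auto).
assert (HFc : forall x, continuous F x).
{ intros x; apply (@ex_derive_continuous _ R_NormedModule).
  exists (G x); apply HF. }
set (K := RInt (fun x => G x * (2 * x + p)) a).
assert (HK : forall x, is_derive K x (G x * (2 * x + p)))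
  by now apply continuous_primitive.
(* A bound for the factor [x + y + p] of [phi x - phi y] on [a,b]. *)
set (L := 2 * (Rabs a + Rabs b) + Rabs p).
assert (Hlip : forall x y, a <= x <= b -> a <= y <= b ->
  Rabs (phi x - phi y) <= L * Rabs (x - y)).
{ intros x y Hx Hy; rewrite !Hphi.
  replace (x ^ 2 + p * x + q - (y ^ 2 + p * y + q))
    with ((x + y + p) * (x - y)) by ring.
  rewrite Rabs_mult; apply Rmult_le_compat_r; [apply Rabs_pos | ].
  unfold L, Rabs; repeat destruct Rcase_abs; lra. }
assert (HI : is_HKInt (fun x => f2 x * phi x) a b
               (G b * phi b - K b - (G a * phi a - K a))).
{ apply (is_HKInt_parts f2 G phi (fun x => 2 * x + p) K a b L Hab); auto.
  - intros x Hx; destruct (HFG x Hx) as [_ ->].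
    destruct (HFG a ltac:(lra)) as [_ ->].
    now apply (C1_HK2_primitive _ _ _ _ _ Hf).
  - unfold L; assert (A1 := Rabs_pos a); assert (A2 := Rabs_pos b).
    assert (A3 := Rabs_pos p); lra. }
split; [now exists (G b * phi b - K b - (G a * phi a - K a)) | ].
unfold quad_formula, quad_error; rewrite (HKInt_correct _ _ _ _ Hab HI).
rewrite (is_derive_unique _ _ _ (Hd a)), (is_derive_unique _ _ _ (Hd b)).
destruct (HFG a ltac:(lra)) as [<- <-]; destruct (HFG b ltac:(lra)) as [<- <-].
assert (HRF : RInt f a b = RInt F a b).
{ apply RInt_ext; intros x Hx.
  rewrite Rmin_left, Rmax_right in Hx by exact Hab.
  symmetry; apply HFG; lra. }
rewrite HRF.
assert (H1 : is_RInt (fun x => 2 * F x) a b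
  (F b * (2 * b + p) - K b - (F a * (2 * a + p) - K a))).
{ apply (@is_RInt_derive R_CompleteNormedModule
    (fun x => F x * (2 * x + p) - K x)).
  - intros x _.
    replace (2 * F x) with (G x * (2 * x + p) + F x * 2 - G x * (2 * x + p)) by ring.
    apply (@is_derive_minus _ R_NormedModule); [ | apply HK].
    apply (@is_derive_mult R_AbsRing F (fun x => 2 * x + p) x (G x) 2);
      [apply HF | | intros; apply Rmult_comm].
    auto_derive; [exact I | ring].
  - intros x _; apply (@continuous_scal_r _ R_AbsRing R_NormedModule 2 F); auto. }
assert (H2 : is_RInt (fun x => 2 * F x) a b (2 * RInt F a b)).
{ apply (@is_RInt_scal R_NormedModule _ _ _ 2 (RInt F a b)).
  apply (@RInt_correct R_CompleteNormedModule).
  apply (@ex_RInt_continuous R_CompleteNormedModule); auto. }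
apply (@is_RInt_unique R_CompleteNormedModule) in H1.
apply (@is_RInt_unique R_CompleteNormedModule) in H2.
assert (H3 : 2 * RInt F a b = F b * (2 * b + p) - K b - (F a * (2 * a + p) - K a))
  by (rewrite <- H2; exact H1).
lra.
Qed.

(* With [m] the midpoint, [Phi s] is the error of the trapezoidal rule on
   [m - s, m + s]; its derivative [- s * (G (m + s) - G (m - s))] is at most
   [2 * N * s] in absolute value. *)
Lemma trapezoid_bound (P F G : R -> R) (k N u v : R) : u <= v ->
  (forall x, is_derive P x (F x)) -> (forall x, is_derive F x (G x)) ->
  (forall x, u <= x <= v -> Rabs (G x - k) <= N) ->
  Rabs (P v - P u - trapezoid F u v) <= N * (v - u) ^ 2 / 4.
Proof.
intros Huv HP HF HG.
set (m := (u + v) / 2); set (r := (v - u) / 2).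
set (Phi := fun s => P (m + s) - P (m - s) - s * (F (m - s) + F (m + s))).
assert (Hd : forall s, is_derive Phi s (- s * (G (m + s) - G (m - s)))).
{ intros s; unfold Phi; auto_derive.
  - repeat split; try (exists (F (m + s)); apply HP);
      try (exists (F (m + - s)); apply HP);
      try (exists (G (m + s)); apply HF); exists (G (m + - s)); apply HF.
  - change (Derive (fun x => P x)) with (Derive P).
    change (Derive (fun x => F x)) with (Derive F).
    rewrite !(is_derive_unique P _ _ (HP _)), !(is_derive_unique F _ _ (HF _)).
    unfold Rminus; ring. }
(* The function [N * s ^ 2 + c * Phi s] vanishes at 0 and has derivative [s * (2 * N - c * (G (m +
   s) - G (m - s)))], which is nonnegative since [k] cancels in the difference. The signs [c = 1]
   and [c = -1] give both halves of the bound. *)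
assert (Hsgn : forall c, Rabs c = 1 -> 0 <= N * r ^ 2 + c * Phi r).
{ intros c Hc.
  destruct (MVT_gen (fun s => N * s ^ 2 + c * Phi s) 0 r
    (fun s => N * (2 * s) + c * (- s * (G (m + s) - G (m - s))))) as [s [Hs E]].
  - intros s _; apply (@is_derive_plus _ R_NormedModule
      (fun s => N * s ^ 2) (fun s => c * Phi s)).
    + auto_derive; [exact I | ring].
    + apply is_derive_scal, Hd.
  - intros s _; apply continuity_pt_filterlim.
    apply (@continuous_plus R_UniformSpace _ R_NormedModule
      (fun s => N * s ^ 2) (fun s => c * Phi s)).
    + apply (@ex_derive_continuous _ R_NormedModule); auto_derive; exact I.
    + apply (@continuous_scal_r _ R_AbsRing R_NormedModule c Phi).
      apply (@ex_derive_continuous _ R_NormedModule); eexists; apply Hd.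
  - rewrite Rmin_left, Rmax_right in Hs by (unfold r; lra).
    assert (H0 : Phi 0 = 0)
      by (unfold Phi; rewrite Rminus_0_r, Rplus_0_r; ring).
    rewrite H0 in E.
    assert (G1 := HG (m + s) ltac:(unfold m, r in *; lra)).
    assert (G2 := HG (m - s) ltac:(unfold m, r in *; lra)).
    assert (HcG : Rabs (c * (G (m + s) - G (m - s))) <= 2 * N).
    { rewrite Rabs_mult, Hc, Rmult_1_l.
      apply Rabs_le_between in G1, G2; apply Rabs_le; lra. }
    apply Rabs_le_between in HcG.
    assert (0 <= (s * r) * (2 * N - c * (G (m + s) - G (m - s))))
      by (apply Rmult_le_pos; [apply Rmult_le_pos | ]; lra).
    lra. }
assert (E : P v - P u - trapezoid F u v = Phi r).
{ unfold Phi, trapezoid; replace (m - r) with u by (unfold m, r; field).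
  replace (m + r) with v by (unfold m, r; field); unfold r; field. }
rewrite E.
assert (H1 := Hsgn 1 Rabs_R1).
assert (H2 := Hsgn (-1) ltac:(unfold Rabs; destruct Rcase_abs; lra)).
replace (N * (v - u) ^ 2 / 4) with (N * r ^ 2) by (unfold r; field).
apply Rabs_le; lra.
Qed.

(** * Uniform partitions and the composite rule *)

Lemma node_S (a b : R) (n i : nat) : (0 < n)%nat ->
  node a b n (S i) = node a b n i + (b - a) / INR n.
Proof.
intros Hn; apply lt_0_INR in Hn; unfold node; rewrite S_INR; field; lra.
Qed.

Lemma node_0 (a b : R) (n : nat) : node a b n 0 = a.
Proof. unfold node; simpl; unfold Rdiv; ring. Qed.

Lemma node_n (a b : R) (n : nat) : (0 < n)%nat -> node a b n n = b.
Proof. intros Hn; apply lt_0_INR in Hn; unfold node; field; lra. Qed.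

Lemma node_in (a b : R) (n i : nat) : a <= b -> (0 < n)%nat -> (i <= n)%nat ->
  a <= node a b n i <= b.
Proof.
intros Hab Hn Hi; unfold node.
apply lt_0_INR in Hn; apply le_INR in Hi; assert (H0 := pos_INR i).
assert (E : (b - a) * INR i / INR n = (b - a) * (INR i / INR n)) by (field; lra).
assert (H1 : 0 <= INR i / INR n) by (apply Rdiv_le_0_compat; lra).
assert (H2 : INR i / INR n <= 1) by (apply Rle_div_l; lra).
rewrite E; nra.
Qed.

Lemma sum_trapezoid (f : R -> R) (a b : R) (n : nat) : (0 < n)%nat ->
  sum_n_m (fun i => trapezoid f (node a b n i) (node a b n (S i))) 0 (n - 1)
  = composite_trapezoid f a b n.
Proof.
intros Hn.
(* Induction on partial sums: each new cell turns the former last node into an interior one and so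
   doubles its weight. *)
assert (H : forall k, sum_n_m
    (fun i => trapezoid f (node a b n i) (node a b n (S i))) 0 k
  = (b - a) / (2 * INR n) * (f a + 2 * sum_n_m (fun i => f (node a b n i)) 1 k
                             + f (node a b n (S k))) :> R).
{ assert (Hn' := lt_0_INR n Hn).
  induction k as [ | k IH].
  - rewrite sum_n_n, sum_n_m_zero by lia.
    change (@zero R_AbelianMonoid) with 0.
    unfold trapezoid; rewrite (node_S _ _ _ _ Hn), node_0; field; lra.
  - rewrite (sum_n_Sm _ 0 k), (sum_n_Sm _ 1 k) by lia.
    rewrite IH; change (@plus R_AbelianMonoid) with Rplus.
    unfold trapezoid; rewrite (node_S _ _ _ (S k) Hn); field; lra. }
rewrite H; unfold composite_trapezoid.
replace (S (n - 1)) with n by lia.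
now rewrite node_n.
Qed.

Lemma composite_trapezoid_1 (f : R -> R) (a b : R) :
  composite_trapezoid f a b 1 = trapezoid f a b.
Proof.
rewrite <- sum_trapezoid by lia; simpl Nat.sub; rewrite sum_n_n, node_0.
now rewrite node_n by lia.
Qed.

Lemma composite_trapezoid_bound (a b : R) (f f1 f2 : R -> R) (n : nat) :
  a <= b -> (0 < n)%nat -> C1_HK2 a b f f1 f2 ->
  Rabs (RInt f a b - composite_trapezoid f a b n)
    <= Alex_norm f2 a b * (b - a) ^ 2 / (4 * INR n).
Proof.
intros Hab Hn Hf.
destruct (C1_HK2_extension a b f f1 f2 Hab Hf) as (F & G & HF & HG & HFG).
set (P := RInt F a).
assert (HP : forall x, is_derive P x (F x)).
{ apply continuous_primitive; intros x.
  apply (@ex_derive_continuous _ R_NormedModule); exists (G x); apply HF. }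
assert (HR : RInt f a b = P b - P a).
{ unfold P; rewrite RInt_point; change (@zero R_AbelianMonoid) with 0.
  rewrite Rminus_0_r; apply RInt_ext; intros x Hx.
  rewrite Rmin_left, Rmax_right in Hx by exact Hab.
  symmetry; apply HFG; lra. }
set (N := Alex_norm f2 a b).
assert (Hn' := lt_0_INR n Hn).
(* The bound for a single cell, to be added [n] times. *)
set (c := N * ((b - a) / INR n) ^ 2 / 4).
assert (H : forall k, (k < n)%nat ->
  Rabs (P (node a b n (S k)) - P a - sum_n_m
    (fun i => trapezoid f (node a b n i) (node a b n (S i))) 0 k)
  <= INR (S k) * c).
{ assert (Hcell : forall k, (k < n)%nat ->
    Rabs (P (node a b n (S k)) - P (node a b n k)
          - trapezoid f (node a b n k) (node a b n (S k))) <= c).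
  { intros k Hk.
    assert (N1 := node_in a b n k Hab Hn ltac:(lia)).
    assert (N2 := node_in a b n (S k) Hab Hn ltac:(lia)).
    assert (E := node_S a b n k Hn).
    assert (0 <= (b - a) / INR n) by (apply Rdiv_le_0_compat; lra).
    replace c with (N * (node a b n (S k) - node a b n k) ^ 2 / 4)
      by (rewrite E; unfold c; field; lra).
    replace (trapezoid f _ _)
      with (trapezoid F (node a b n k) (node a b n (S k)))
      by (unfold trapezoid; destruct (HFG _ N1) as [-> _];
          now destruct (HFG _ N2) as [-> _]).
    (* Centring at [f1 a] on every cell, rather than at the value at its left end, lets the norm
       over [a,b] serve directly. *)
    apply (trapezoid_bound P F G (f1 a)); auto; [lra | ].
    intros x Hx; destruct (HFG x ltac:(lra)) as [_ ->].
    apply (Alex_norm_bound a b f f1 f2 Hab Hf); lra. }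
  induction k as [ | k IH]; intros Hk.
  - assert (H0 := Hcell 0%nat Hk); rewrite node_0 in H0.
    rewrite sum_n_n, node_0, Rmult_1_l; exact H0.
  - rewrite sum_n_Sm by lia.
    change (@plus R_AbelianMonoid) with Rplus.
    specialize (IH ltac:(lia)); assert (H1 := Hcell (S k) Hk).
    rewrite (S_INR (S k)).
    apply Rabs_le_between in IH, H1; apply Rabs_le; lra. }
specialize (H (n - 1)%nat ltac:(lia)).
rewrite sum_trapezoid in H by exact Hn.
replace (S (n - 1)) with n in H by lia.
rewrite node_n in H by exact Hn.
rewrite HR.
replace (N * (b - a) ^ 2 / (4 * INR n)) with (INR n * c) by (unfold c; field; lra).
exact H.
Qed.

(** * Extremal functions *)

Lemma is_derive_asin (y : R) : -1 < y < 1 -> is_derive asin y (/ sqrt (1 - y ^ 2)).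
Proof.
intros Hy; apply is_derive_Reals.
replace (/ sqrt (1 - y ^ 2)) with (derive_pt asin y (derivable_pt_asin y Hy)).
- exact (proj2_sig (derivable_pt_asin y Hy)).
- rewrite derive_pt_asin; unfold Rdiv; rewrite Rmult_1_l, Rsqr_pow2; reflexivity.
Qed.

Lemma RInt_shift (f : R -> R) (a b s : R) : (forall x, continuous f x) ->
  RInt (fun x => f (x + s)) a b = RInt f (a + s) (b + s).
Proof.
intros Hf.
assert (H := @RInt_comp_lin R_CompleteNormedModule f 1 s a b).
rewrite !Rmult_1_l in H; rewrite <- H.
- apply RInt_ext; intros x _.
  transitivity (1 * f (1 * x + s)); [now rewrite !Rmult_1_l | reflexivity].
- apply (@ex_RInt_continuous R_CompleteNormedModule); auto.
Qed.

(** Shifting the interval by [s] changes the sign of the integral, but by periodicity it also leaves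
    the integral unchanged. *)
Lemma RInt_antiperiodic (f : R -> R) (a b s : R) : (forall x, continuous f x) ->
  (forall x, f (x + s) = - f x) -> (forall x, f (x + (b - a)) = f x) ->
  RInt f a b = 0.
Proof.
intros Hf Hs HT.
assert (Hex : forall x y, ex_RInt f x y)
  by (intros; apply (@ex_RInt_continuous R_CompleteNormedModule); auto).
assert (E1 : RInt f (a + s) (b + s) = - RInt f a b).
{ rewrite <- RInt_shift by exact Hf.
  rewrite (RInt_ext _ (fun x => - f x)) by (intros; apply Hs).
  apply (@RInt_opp R_CompleteNormedModule f a b), Hex. }
assert (E2 : RInt f b (b + s) = RInt f a (a + s)).
{ replace (b + s) with (a + s + (b - a)) by ring.
  replace b with (a + (b - a)) at 1 by ring.
  rewrite <- RInt_shift by exact Hf; apply RInt_ext; intros; apply HT. }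
assert (E3 := @RInt_Chasles R_CompleteNormedModule f a b (b + s) (Hex _ _) (Hex _ _)).
assert (E4 := @RInt_Chasles R_CompleteNormedModule f a (a + s) (b + s)
  (Hex _ _) (Hex _ _)).
rewrite <- E4 in E3; change (RInt f a b + RInt f b (b + s)
  = RInt f a (a + s) + RInt f (a + s) (b + s)) in E3.
rewrite E1, E2 in E3; lra.
Qed.

(** * Smoothed triangular waves *)

Section Wave.

Variables (rho A w a : R).
Hypothesis Hrho : 0 < rho < PI / 2.

(** Without the factor [sin rho] this is a triangular wave; that factor keeps the argument inside
    the open interval where [asin] is differentiable. *)
Definition wave (x : R) : R := A * asin (sin rho * cos (w * (x - a))).

Definition wave' (x : R) : R :=
  - A * w * (sin rho * sin (w * (x - a)))
    / sqrt (1 - (sin rho * cos (w * (x - a))) ^ 2).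

Lemma sin_rho_bound : 0 < sin rho < 1.
Proof.
assert (HPI := PI_RGT_0).
split; [apply sin_gt_0; lra | ].
rewrite <- sin_PI2; apply sin_increasing_1; lra.
Qed.

Lemma wave_arg_bound (x : R) : -1 < sin rho * cos (w * (x - a)) < 1.
Proof.
assert (H1 := sin_rho_bound); assert (H2 := COS_bound (w * (x - a))); nra.
Qed.

Lemma wave_radicand_pos (x : R) : 0 < 1 - (sin rho * cos (w * (x - a))) ^ 2.
Proof. assert (H := wave_arg_bound x); nra. Qed.

Lemma is_derive_wave (x : R) : is_derive wave x (wave' x).
Proof.
assert (Hr := wave_radicand_pos x).
assert (Hs := sqrt_lt_R0 _ Hr).
replace (wave' x) with (A * ((- sin rho * w * sin (w * (x - a)))
    * / sqrt (1 - (sin rho * cos (w * (x - a))) ^ 2)))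
  by (unfold wave'; field; lra).
apply is_derive_scal.
apply (@is_derive_comp _ R_NormedModule asin (fun x => sin rho * cos (w * (x - a)))).
- apply is_derive_asin, wave_arg_bound.
- auto_derive; [exact I | unfold Rminus; ring].
Qed.

Lemma wave_C1_HK2 (b : R) : a <= b -> C1_HK2 a b wave wave' (Derive wave').
Proof.
intros Hab; apply C1_HK2_everywhere; [exact Hab | | ]; intros x _;
  apply D_in_is_derive; [apply is_derive_wave | apply Derive_correct].
assert (Hr := wave_radicand_pos x).
assert (Hs := sqrt_lt_R0 _ Hr).
unfold wave'; auto_derive.
replace (w * (x + - a)) with (w * (x - a)) by ring.
split; [ | split; [ | exact I]].
- replace (1 + - _) with (1 - (sin rho * cos (w * (x - a))) ^ 2) by ring; exact Hr.
- apply Rgt_not_eq.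
  replace (1 + - _) with (1 - (sin rho * cos (w * (x - a))) ^ 2) by ring; exact Hs.
Qed.

(** With [S] and [C] the sine and cosine, [sin rho ^ 2 * (S ^ 2 + C ^ 2) <= 1], so the root in the
    denominator dominates [Rabs (sin rho * S)]. *)
Lemma wave'_bound (x : R) : Rabs (wave' x) <= Rabs (A * w).
Proof.
assert (Hr := wave_radicand_pos x).
assert (Hs := sqrt_lt_R0 _ Hr).
assert (H1 := sin_rho_bound).
assert (H2 := sin2_cos2 (w * (x - a))); rewrite !Rsqr_pow2 in H2.
unfold wave'.
set (S := sin (w * (x - a))) in *; set (C := cos (w * (x - a))) in *.
set (q := sqrt (1 - (sin rho * C) ^ 2)) in *.
assert (H3 : Rabs (sin rho * S) <= q).
{ rewrite <- sqrt_Rsqr_abs; apply sqrt_le_1_alt; rewrite Rsqr_pow2.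
  assert (sin rho ^ 2 <= 1) by nra.
  rewrite !Rpow_mult_distr; nra. }
replace (- A * w * (sin rho * S) / q) with (A * w * (- (sin rho * S) / q))
  by (field; lra).
rewrite Rabs_mult; rewrite <- (Rmult_1_r (Rabs (A * w))) at 2.
apply Rmult_le_compat_l; [apply Rabs_pos | ].
unfold Rdiv; rewrite Rabs_mult, Rabs_Ropp, Rabs_inv, (Rabs_pos_eq q) by lra.
apply Rle_div_l; lra.
Qed.

Lemma wave_period (x : R) (k : nat) (T : R) : w * T = 2 * INR k * PI ->
  wave (x + T) = wave x.
Proof.
intros HT; unfold wave.
replace (w * (x + T - a)) with (w * (x - a) + 2 * INR k * PI)
  by (rewrite <- HT; ring).
now rewrite cos_period.
Qed.

Lemma wave'_period (x : R) (k : nat) (T : R) : w * T = 2 * INR k * PI ->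
  wave' (x + T) = wave' x.
Proof.
intros HT; unfold wave'.
replace (w * (x + T - a)) with (w * (x - a) + 2 * INR k * PI)
  by (rewrite <- HT; ring).
now rewrite cos_period, sin_period.
Qed.

Lemma wave_antiperiod (x s : R) : w * s = PI -> wave (x + s) = - wave x.
Proof.
intros Hs; unfold wave.
replace (w * (x + s - a)) with (w * (x - a) + PI) by (rewrite <- Hs; ring).
rewrite neg_cos, <- Ropp_mult_distr_r, asin_opp; ring.
Qed.

Lemma wave_start : wave a = A * rho.
Proof.
unfold wave; rewrite Rminus_diag, Rmult_0_r, cos_0, Rmult_1_r.
rewrite asin_sin; [reflexivity | lra].
Qed.

Lemma wave'_start : wave' a = 0.
Proof.
unfold wave'; rewrite Rminus_diag, Rmult_0_r, sin_0; unfold Rdiv; ring.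
Qed.

End Wave.

(* As [rho -> PI/2], [f] tends to the triangular wave of slopes [M] and [-M]
   with its crests at the nodes. *)
Lemma extremal_function (a b M rho : R) (n : nat) :
  a < b -> 0 <= M -> 0 < rho < PI / 2 -> (0 < n)%nat ->
  exists f f1 f2 : R -> R, C1_HK2 a b f f1 f2 /\ Alex_norm f2 a b <= M /\
    f1 a = 0 /\ f1 b = 0 /\ RInt f a b = 0 /\
    forall i, f (node a b n i) = M * (b - a) / (2 * PI * INR n) * rho.
Proof.
intros Hab HM Hrho Hn.
assert (Hn' := lt_0_INR n Hn).
assert (HPI := PI_RGT_0).
(* [w] puts exactly one period between consecutive nodes; [A] makes the slope bound [A * w] equal to
   [M]. *)
set (w := 2 * PI * INR n / (b - a)).
set (A := M * (b - a) / (2 * PI * INR n)).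
assert (HAw : A * w = M) by (unfold A, w; field; lra).
assert (HwT : w * (b - a) = 2 * INR n * PI) by (unfold w; field; lra).
assert (Hf := wave_C1_HK2 rho A w a Hrho b ltac:(lra)).
exists (wave rho A w a), (wave' rho A w a), (Derive (wave' rho A w a)).
split; [exact Hf | split; [ | split; [ | split; [ | split]]]].
- apply (Alex_norm_le a b _ _ _ M ltac:(lra) Hf).
  intros x _; rewrite wave'_start, Rminus_0_r.
  apply Rle_trans with (1 := wave'_bound rho A w a Hrho x).
  rewrite HAw, Rabs_pos_eq; lra.
- apply wave'_start.
- replace b with (a + (b - a)) by ring.
  rewrite (wave'_period _ _ _ _ _ n) by exact HwT; apply wave'_start.
(* The shift is half a period. *)
- apply RInt_antiperiodic with ((b - a) / (2 * INR n)).
  + intros x; apply (@ex_derive_continuous _ R_NormedModule).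
    eexists; now apply is_derive_wave.
  + intros x; apply wave_antiperiod; unfold w; field; lra.
  + intros x; now apply (wave_period _ _ _ _ _ n).
- intros i; unfold node.
  replace (a + (b - a) * INR i / INR n) with (a + (b - a) / INR n * INR i)
    by (field; lra).
  rewrite (wave_period _ _ _ _ _ i) by (unfold w; field; lra).
  now apply wave_start.
Qed.

(** * Sharpness of the constants *)

Lemma composite_trapezoid_const (f : R -> R) (a b v : R) (n : nat) : (0 < n)%nat ->
  (forall i, f (node a b n i) = v) -> composite_trapezoid f a b n = (b - a) * v.
Proof.
intros Hn Hf; assert (Hn' := lt_0_INR n Hn).
unfold composite_trapezoid.
rewrite (sum_n_m_ext _ (fun _ => v)) by exact Hf.
rewrite sum_n_m_const.
replace (S (n - 1) - 1)%nat with (n - 1)%nat by lia.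
rewrite minus_INR by lia.
assert (Ha := Hf 0%nat); rewrite node_0 in Ha.
assert (Hb := Hf n); rewrite node_n in Hb by exact Hn.
rewrite Ha, Hb; simpl INR; field; lra.
Qed.

Lemma le_limit_PI2 (K C : R) : 0 <= K ->
  (forall rho, 0 < rho < PI / 2 -> K * rho <= C) -> K * (PI / 2) <= C.
Proof.
intros HK H; apply le_epsilon; intros e He.
assert (HPI := PI_RGT_0).
(* [PI / 4] keeps [PI / 2 - d] positive; the other bound makes the loss [K * d] at most [e], with
   [K + 1] positive even for [K = 0]. *)
set (d := Rmin (PI / 4) (e / (K + 1))).
assert (Hd : 0 < d) by (apply Rmin_pos; [lra | apply Rdiv_lt_0_compat; lra]).
assert (H1 : d <= PI / 4) by apply Rmin_l.
assert (H2 : d <= e / (K + 1)) by apply Rmin_r.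
apply Rle_div_r in H2; [ | lra].
assert (H3 := H (PI / 2 - d) ltac:(lra)); lra.
Qed.

(** The extremal functions with [M = 1] have integral 0 and equal values at all nodes, so their
    error is [(b - a) ^ 2 / (2 * PI * INR n) * rho] in absolute value. *)
Lemma composite_trapezoid_sharp (a b C : R) (n : nat) : a < b -> (0 < n)%nat ->
  (forall f f1 f2 : R -> R, C1_HK2 a b f f1 f2 ->
     Rabs (RInt f a b - composite_trapezoid f a b n) <= C * Alex_norm f2 a b) ->
  (b - a) ^ 2 / (4 * INR n) <= C.
Proof.
intros Hab Hn HC; assert (Hn' := lt_0_INR n Hn); assert (HPI := PI_RGT_0).
replace ((b - a) ^ 2 / (4 * INR n))
  with ((b - a) ^ 2 / (2 * PI * INR n) * (PI / 2)) by (field; lra).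
assert (HK : 0 < (b - a) ^ 2 / (2 * PI * INR n)).
{ apply Rdiv_lt_0_compat; [apply pow_lt; lra | ].
  apply Rmult_lt_0_compat; lra. }
apply le_limit_PI2; [lra | intros rho Hrho].
destruct (extremal_function a b 1 rho n Hab Rle_0_1 Hrho Hn)
  as (f & f1 & f2 & Hf & HN & _ & _ & HI & Hv).
assert (H := HC f f1 f2 Hf).
rewrite HI, (composite_trapezoid_const _ _ _ _ _ Hn Hv) in H.
rewrite Rminus_0_l, Rabs_Ropp in H.
replace ((b - a) * (1 * (b - a) / (2 * PI * INR n) * rho))
  with ((b - a) ^ 2 / (2 * PI * INR n) * rho) in H by (field; lra).
assert (Hp := Rmult_lt_0_compat _ _ HK (proj1 Hrho)).
rewrite Rabs_pos_eq in H by lra.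
assert (HN0 := Alex_norm_bound a b f f1 f2 ltac:(lra) Hf a ltac:(lra)).
rewrite Rminus_diag, Rabs_R0 in HN0.
apply Rle_trans with (1 := H).
(* The norm lies between 0 and 1; a negative [C] would contradict the positive error in [H]. *)
destruct (Rle_lt_dec 0 C) as [HC0 | HC0]; nra.
Qed.

(** For the extremal [f] with [n = 1], [f'] vanishes at both ends and [f a = f b], so [phi] enters
    only through [phi' b - phi' a = 2 * (b - a)], the same for every monic quadratic. The error is
    [- f a * (b - a)]. *)
Lemma worst_error_lower_bound (a b M : R) (phi : R -> R) : a < b -> 0 <= M ->
  monic_quadratic phi -> Rbar_le (M * (b - a) ^ 2 / 4) (worst_error phi a b M).
Proof.
intros Hab HM Hphi; assert (HPI := PI_RGT_0).
assert (H : forall rho, 0 < rho < PI / 2 ->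
  Rbar_le (M * (b - a) ^ 2 / (2 * PI) * rho) (worst_error phi a b M)).
{ intros rho Hrho.
  destruct (extremal_function a b M rho 1 Hab HM Hrho ltac:(lia))
    as (f & f1 & f2 & Hf & HN & Ha & Hb & HI & Hv).
  apply (proj1 (Lub_Rbar_correct _)).
  exists f, f1, f2; split; [exact Hf | split; [exact HN | ]].
  destruct (quad_formula_error a b f f1 f2 phi ltac:(lra) Hf Hphi) as [_ E].
  destruct Hphi as (p & q & Hphi).
  assert (Hd := is_derive_monic_quadratic phi p q Hphi).
  unfold quad_formula in E.
  rewrite (is_derive_unique _ _ _ (Hd a)), (is_derive_unique _ _ _ (Hd b)) in E.
  rewrite HI, Ha, Hb in E.
  assert (Va := Hv 0%nat); rewrite node_0 in Va.
  assert (Vb := Hv 1%nat); rewrite node_n in Vb by lia.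
  rewrite Va, Vb in E; change (INR 1) with 1 in E.
  replace (quad_error phi f2 a b) with (- (M * (b - a) ^ 2 / (2 * PI) * rho)).
  - rewrite Rabs_Ropp, Rabs_pos_eq; [reflexivity | ].
    apply Rmult_le_pos; [ | lra]; apply Rdiv_le_0_compat; [ | lra].
    apply Rmult_le_pos; [exact HM | apply pow2_ge_0].
  - assert (E' : M * (b - a) / (2 * PI * 1) * rho * (b - a)
      = M * (b - a) ^ 2 / (2 * PI) * rho) by (field; lra).
    rewrite <- E'; lra. }
(* Only a finite value requires the limit in [rho]; [m_infty] is refuted by a single [rho]. *)
destruct (worst_error phi a b M) as [l | | ]; unfold Rbar_le in *.
- replace (M * (b - a) ^ 2 / 4) with (M * (b - a) ^ 2 / (2 * PI) * (PI / 2))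
    by (field; lra).
  apply le_limit_PI2; [ | exact H].
  apply Rdiv_le_0_compat; [ | lra].
  apply Rmult_le_pos; [exact HM | apply pow2_ge_0].
- exact I.
- apply (H (PI / 4)); lra.
Qed.

Theorem theorem5p1 (a b : R) (hab : a < b) :
  let c := (a + b) / 2 in
  let phi0 := fun x : R => (x - c) ^ 2 - (b - a) ^ 2 / 4 in
  (monic_quadratic phi0 /\ forall x : R, phi0 x = (x - a) * (x - b)) /\
  (* formula ( * ) for an arbitrary monic quadratic phi *)
  (forall f f1 f2 : R -> R, C1_HK2 a b f f1 f2 ->
     ex_RInt f a b /\
     forall phi : R -> R, monic_quadratic phi ->
       ex_HKInt (fun x => f2 x * phi x) a b /\
       RInt f a b = quad_formula phi f f1 a b + quad_error phi f2 a b) /\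
  (* phi0 minimizes the error *)
  (forall (phi : R -> R) (M : R), monic_quadratic phi -> 0 <= M ->
     Rbar_le (worst_error phi0 a b M) (worst_error phi a b M)) /\
  (* the formula generated by phi0, its error bound and sharpness *)
  (forall f f1 f2 : R -> R, C1_HK2 a b f f1 f2 ->
     RInt f a b = trapezoid f a b + quad_error phi0 f2 a b /\
     Rabs (quad_error phi0 f2 a b) <= Alex_norm f2 a b * (b - a) ^ 2 / 4) /\
  (forall C : R,
     (forall f f1 f2 : R -> R, C1_HK2 a b f f1 f2 ->
        Rabs (RInt f a b - trapezoid f a b) <= C * Alex_norm f2 a b) ->
     (b - a) ^ 2 / 4 <= C) /\
  (* the composite formula, its error bound and sharpness *)
  (forall n : nat, (0 < n)%nat ->
     (forall f : R -> R,
        sum_n_m (fun i => trapezoid f (node a b n i) (node a b n (S i)))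
          0 (n - 1) = composite_trapezoid f a b n) /\
     (forall f f1 f2 : R -> R, C1_HK2 a b f f1 f2 ->
        Rabs (RInt f a b - composite_trapezoid f a b n)
          <= Alex_norm f2 a b * (b - a) ^ 2 / (4 * INR n)) /\
     (forall C : R,
        (forall f f1 f2 : R -> R, C1_HK2 a b f f1 f2 ->
           Rabs (RInt f a b - composite_trapezoid f a b n)
             <= C * Alex_norm f2 a b) ->
        (b - a) ^ 2 / (4 * INR n) <= C)).
Proof.
intros c phi0.
assert (Hphi0 : forall x, phi0 x = (x - a) * (x - b))
  by (intros x; unfold phi0, c; field).
assert (Hmon : monic_quadratic phi0).
{ exists (- (a + b)), (a * b); intros x; rewrite Hphi0; ring. }
(* [phi0] vanishes at both ends, which removes [f'], and its derivatives there are [- (b - a)] and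
   [b - a]. *)
assert (Hquad : forall f f1, quad_formula phi0 f f1 a b = trapezoid f a b).
{ intros f f1; unfold quad_formula, trapezoid.
  assert (Hd : forall x, is_derive phi0 x (2 * x + - (a + b))).
  { apply is_derive_monic_quadratic with (a * b).
    intros x; rewrite Hphi0; ring. }
  rewrite (is_derive_unique _ _ _ (Hd a)), (is_derive_unique _ _ _ (Hd b)).
  rewrite !Hphi0; field. }
assert (Herr : forall f f1 f2, C1_HK2 a b f f1 f2 ->
  RInt f a b = trapezoid f a b + quad_error phi0 f2 a b /\
  Rabs (quad_error phi0 f2 a b) <= Alex_norm f2 a b * (b - a) ^ 2 / 4).
{ intros f f1 f2 Hf.
  destruct (quad_formula_error a b f f1 f2 phi0 ltac:(lra) Hf Hmon) as [_ E].
  rewrite Hquad in E; split; [exact E | ].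
  assert (B := composite_trapezoid_bound a b f f1 f2 1 ltac:(lra) ltac:(lia) Hf).
  rewrite composite_trapezoid_1, E in B.
  change (INR 1) with 1 in B; rewrite Rmult_1_r in B.
  now replace (quad_error phi0 f2 a b)
    with (trapezoid f a b + quad_error phi0 f2 a b - trapezoid f a b) by ring. }
split; [split; [exact Hmon | exact Hphi0] | ].
split; [ | split; [ | split; [exact Herr | split]]].
- intros f f1 f2 Hf; split; [now apply (C1_HK2_ex_RInt a b f f1 f2); [lra | ] | ].
  intros phi Hphi; apply (quad_formula_error a b f f1 f2 phi ltac:(lra) Hf Hphi).
- intros phi M Hphi HM.
  (* The lower bound valid for every [phi] is also an upper bound for [phi0]. *)
  apply Rbar_le_trans with (2 := worst_error_lower_bound a b M phi hab HM Hphi).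
  apply (proj2 (Lub_Rbar_correct _)); intros y (f & f1 & f2 & Hf & HN & ->).
  apply Rle_trans with (1 := proj2 (Herr f f1 f2 Hf)).
  assert (H2 := pow2_ge_0 (b - a)).
  assert (H3 := Rmult_le_compat_r _ _ _ H2 HN); simpl in *; lra.
- intros C HC.
  replace ((b - a) ^ 2 / 4) with ((b - a) ^ 2 / (4 * INR 1)) by (simpl; field).
  apply composite_trapezoid_sharp; [exact hab | lia | ].
  intros f f1 f2 Hf; rewrite composite_trapezoid_1; now apply HC with f1.
- intros n Hn; split; [ | split].
  + intros f; now apply sum_trapezoid.
  + intros f f1 f2 Hf; apply composite_trapezoid_bound with f1; auto; lra.
  + intros C; now apply composite_trapezoid_sharp.
Qed.
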